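(* Let $n\ge 1$, let $\Sigma_n$ be the symmetric group on $\{1,\dots,n\}$, and let $G$ be any subgroup of $\Sigma_n$. Let $X^n=\{(x_1,\ldots,x_n)\in(\mathbb{R}^3)^n : i\neq j\implies x_i\neq x_j\}$, and let $X^n/G$ be the quotient of $X^n$ by the action of $G$ permuting coordinates. Then $X^n/G$ is a metrizable $(3n)$-dimensional manifold.
   Context: $\mathbb{R}^3$ has its usual topology and $X^n\subset(\mathbb{R}^3)^n\cong\mathbb{R}^{3n}$ has the subspace topology (Euclidean metric). The group $G\le\Sigma_n$ acts on $X^n$ by permuting components: $\sigma*(x_1,\ldots,x_n)=(x_{\sigma(1)},\ldots,x_{\sigma(n)})$ for $\sigma\in G$. The space $X^n/G$ is the set of orbits of this action, with the quotient topology. ''Manifold'' means topological manifold (without boundary). *)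

(* Defs.v *)
From HB Require Import structures.
From mathcomp Require Import all_boot all_order all_algebra all_fingroup.
From mathcomp Require Import generic_quotient.
From mathcomp Require Import all_classical all_reals all_analysis.

Set Implicit Arguments.
Unset Strict Implicit.
Unset Printing Implicit Defensive.

Import Order.TTheory GRing.Theory Num.Theory.
Import numFieldNormedType.Exports.

Local Open Scope classical_set_scope.
Local Open Scope ring_scope.
Local Open Scope quotient_scope.

Definition homeomorphic (S T : topologicalType) : Prop :=
  exists (f : S -> T) (g : T -> S),
    [/\ continuous f, continuous g, cancel f g & cancel g f].

Definition metrizable (R : realType) (T : topologicalType) : Prop :=
  exists M : metricType R, homeomorphic T M.

(* Below, [U] and [V] are coerced to subtypes ([set_type]), which carry the
   subspace topology. *)
Definition locally_euclidean (R : realType) (d : nat) (T : topologicalType) :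
    Prop :=
  forall x : T, exists (U : set T) (V : set 'rV[R]_d),
    [/\ open U, U x, open V & homeomorphic U V].

Definition topological_manifold (R : realType) (d : nat)
    (T : topologicalType) : Prop :=
  [/\ hausdorff_space T, @second_countable T & locally_euclidean R d T].

Section Configurations.
Variables (R : realType) (n : nat).

(* A point (x_1, ..., x_n) of (R^3)^n is the n x 3 matrix with rows x_i; the
   topology on matrices is the product topology. *)
Definition distinct_points : set 'M[R]_(n, 3) :=
  [set x | forall i j : 'I_n, i <> j -> row i x <> row j x].

Definition configuration : topologicalType := set_type distinct_points.

Lemma row_perm_distinct (s : 'S_n) (x : 'M[R]_(n, 3)) :
  distinct_points x -> distinct_points (row_perm s x).
Proof.
have rowE i : row i (row_perm s x) = row (s i) x.
  by apply/rowP => k; rewrite !mxE.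
by move=> dx i j nij; rewrite !rowE; apply: dx => /perm_inj.
Qed.

(* Row i of [row_perm s x] is row (s i) of x, so this is
   s * (x_1, ..., x_n) = (x_(s 1), ..., x_(s n)). *)
Definition perm_configuration (s : 'S_n) (x : configuration) : configuration :=
  exist _ (row_perm s (\val x))
    (mem_set (row_perm_distinct (s := s) (set_mem (svalP x)))).

Lemma val_perm_configuration s x :
  \val (perm_configuration s x) = row_perm s (\val x).
Proof. by []. Qed.

Variable G : {group 'S_n}.

Definition same_orbit (x y : configuration) : bool :=
  [exists s in G, perm_configuration s x == y].

Lemma same_orbit_refl : reflexive same_orbit.
Proof.
move=> x; apply/existsP; exists 1%g; rewrite group1 /=.
by apply/eqP/val_inj; rewrite val_perm_configuration row_perm1.
Qed.

Lemma same_orbit_sym : symmetric same_orbit.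
Proof.
suff sub x y : same_orbit x y -> same_orbit y x.
  by move=> x y; apply/idP/idP; exact: sub.
move=> /existsP[s /andP[sG /eqP <-]].
apply/existsP; exists s^-1%g; rewrite groupV sG /=.
by apply/eqP/val_inj; rewrite !val_perm_configuration -row_permM mulVg row_perm1.
Qed.

Lemma same_orbit_trans : transitive same_orbit.
Proof.
move=> y x z /existsP[s /andP[sG /eqP <-]] /existsP[t /andP[tG /eqP <-]].
apply/existsP; exists (t * s)%g; rewrite groupM //=.
by apply/eqP/val_inj; rewrite !val_perm_configuration row_permM.
Qed.

Definition same_orbit_equiv : equiv_rel configuration :=
  EquivRel same_orbit same_orbit_refl same_orbit_sym same_orbit_trans.

Definition orbit_space : topologicalType :=
  quotient_topology {eq_quot same_orbit_equiv}.

End Configurations.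

(* Main.v *)
(** The sup norm on n x 3 matrices is invariant under row permutations, so
    d([x], [y]) = min_{s in G} |x - s y| is a metric on the orbit space, and it
    induces the quotient topology.  The projection is continuous and open, hence
    the orbit space is second countable.  If the rows of x are pairwise at
    distance at least d, the ball of radius d/2 around x consists of
    configurations and meets every orbit at most once, so the projection
    restricts to a homeomorphism from this ball onto an open neighbourhood of
    [x]. *)

Require Import Defs.
From HB Require Import structures.
From mathcomp Require Import all_boot all_order all_algebra all_fingroup.
From mathcomp Require Import generic_quotient.
From mathcomp Require Import all_classical all_reals all_analysis.

Set Implicit Arguments.
Unset Strict Implicit.
Unset Printing Implicit Defensive.

Import Order.TTheory GRing.Theory Num.Theory.
Import numFieldNormedType.Exports.

Local Open Scope classical_set_scope.
Local Open Scope ring_scope.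
Local Open Scope quotient_scope.

(** * Homeomorphisms, open maps and second countability *)

Lemma continuous_set_val (S T : topologicalType) (A : set T) (f : S -> A) :
  continuous (set_val \o f) -> continuous f.
Proof. by move=> cf; apply/continuous_comp_initial. Qed.

Lemma homeomorphic_sym (S T : topologicalType) :
  homeomorphic S T -> homeomorphic T S.
Proof. by move=> [f [g [cf cg fK gK]]]; exists g, f. Qed.

Lemma homeomorphic_trans (S T U : topologicalType) :
  homeomorphic S T -> homeomorphic T U -> homeomorphic S U.
Proof.
move=> [f [g [cf cg fK gK]]] [f' [g' [cf' cg' fK' gK']]].
exists (f' \o f), (g \o g'); split; [| | exact: can_comp | exact: can_comp].
- by move=> x; apply: continuous_comp; [exact: cf|exact: cf'].
- by move=> x; apply: continuous_comp; [exact: cg'|exact: cg].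
Qed.

Lemma homeomorphic_image (S T : topologicalType) (f : S -> T) (W : set S) :
  continuous f -> (forall A, open A -> open (f @` A)) -> open W ->
  {in W &, injective f} -> homeomorphic W (f @` W).
Proof.
move=> cf fo oW fI.
pose F (w : W) : f @` W :=
  exist _ (f (\val w)) (mem_set (imageP f (set_mem (svalP w)))).
have FE (t : f @` W) : exists w : W, F w = t.
  case: t => t ft; have [w Ww wt] := set_mem ft.
  exists (exist _ w (mem_set Ww)); exact: val_inj.
pose H t := sval (cid (FE t)).
have HK : cancel H F by move=> t; rewrite /H; case: cid.
have FI : injective F.
  move=> [w Ww] [v Wv] /(congr1 val) /= fwv; apply: val_inj => /=.
  exact: fI.
exists F, H; split => //; last by move=> w; exact: FI.
- apply: continuous_set_val => w.
  by apply: (@continuous_comp _ _ _ (set_val : W -> S) f);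
    [exact: initial_continuous|exact: cf].
- apply/continuousP => _ [A oA <-].
  exists (f @` (A `&` W)); first by apply: fo; exact: openI.
  apply/seteqP; split=> [t /= [x [Ax Wx] ft]|t /= At].
    suff -> : H t = exist _ x (mem_set Wx) by [].
    by apply: FI; rewrite HK; apply: val_inj.
  exists (\val (H t)); first by split=> //; exact: set_mem (svalP (H t)).
  by rewrite -[in RHS](HK t).
Qed.

Lemma second_countable_initial (S : choiceType) (T : topologicalType)
    (f : S -> T) :
  @second_countable T -> @second_countable (initial_topology f).
Proof.
move=> [B cB [oB bB]]; exists ((fun A => f @^-1` A) @` B).
  exact: sub_countable (card_image_le _ _) cB.
split=> [_ [A BA <-]|x A [_ [[V oV <-] Vx VA]]]; first by exists A => //; exact: oB.
have [U [BU Ux] UV] := bB (f x) V (open_nbhs_nbhs (conj oV Vx)).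
exists (f @^-1` U); first by split=> //; exists U.
by move=> y /UV; exact: VA.
Qed.

(** The images of a base form a base: continuity fits a basic set into the preimage of a given open
    set, and openness of [f] keeps its image open. *)
Lemma second_countable_open_image (S T : topologicalType) (f : S -> T) :
  continuous f -> (forall A, open A -> open (f @` A)) ->
  (forall y, exists x, f x = y) -> @second_countable S -> @second_countable T.
Proof.
move=> cf fo fs [B cB [oB bB]]; exists ((fun A => f @` A) @` B).
  exact: sub_countable (card_image_le _ _) cB.
split=> [_ [A BA <-]|y A yA]; first by apply: fo; exact: oB.
have [x xy] := fs y; rewrite -xy in yA *.
have [U [BU Ux] UA] := bB x _ (cf x A yA).
exists (f @` U); first by split; [exists U|exists x].
by move=> _ [z /UA Az <-].
Qed.

(** The base consists of the balls with rational centre and radius [1 / (k + 1)]. *)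
Lemma second_countable_matrix (R : realType) m n :
  @second_countable 'M[R]_(m, n).
Proof.
pose b (ck : 'M[rat]_(m, n) * nat) : set 'M[R]_(m, n) :=
  ball (map_mx ratr ck.1 : 'M[R]_(m, n)) ck.2.+1%:R^-1.
exists (range b).
  exact: sub_countable (card_image_le _ _) (countableP _).
split=> [_ [ck _ <-]|x A /nbhs_ballP[e /= e0 eA]]; first exact: ball_open.
(* With a radius below [e / 2], any such ball that contains [x] lies in the ball of radius [e]
   around [x]. *)
have [k ke] : exists k, k.+1%:R^-1 < e / 2.
  have e20 : 0 < e / 2 by rewrite divr_gt0.
  have [k _ /(_ k (leqnn k)) /=] := near_infty_natSinv_lt (PosNum e20).
  by exists k.
have k0 : 0 < k.+1%:R^-1 :> R by rewrite invr_gt0.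
have qx i j : exists q : rat, ball (ratr q : R) k.+1%:R^-1 (x i j).
  have /rat_in_itvoo[q] : x i j - k.+1%:R^-1 < x i j + k.+1%:R^-1 by
    rewrite ltrBlDr -addrA ltrDl addr_gt0.
  rewrite in_itv /= => /andP[q1 q2]; exists q; rewrite /ball /=.
  by rewrite ltr_distl q1.
pose c := \matrix_(i, j) sval (cid (qx i j)).
have cx : ball (map_mx ratr c : 'M[R]_(m, n)) k.+1%:R^-1 x.
  by split=> // i j; rewrite !mxE; case: cid.
exists (b (c, k)); first by split=> //; exists (c, k).
move=> y cy; apply: eA; rewrite (splitr e).
apply: (ball_triangle (le_ball (ltW ke) (ball_sym cx))).
exact: (le_ball (ltW ke) cy).
Qed.

(** * The sup norm, row permutations and rows *)

Lemma norm_row_perm_le (R : realType) m n (s : 'S_m) (x : 'M[R]_(m, n)) :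
  `|row_perm s x| <= `|x|.
Proof.
rewrite ![`|_|]mx_normrE; apply/bigmax_leP; split=> [|[i j] _ /=].
  exact: bigmax_ge_id.
by rewrite mxE; apply: (le_bigmax _ (fun ij => `|x ij.1 ij.2|) (s i, j)).
Qed.

Lemma norm_row_perm (R : realType) m n (s : 'S_m) (x : 'M[R]_(m, n)) :
  `|row_perm s x| = `|x|.
Proof.
apply/eqP; rewrite eq_le norm_row_perm_le /=.
rewrite -[leLHS](_ : `|row_perm s^-1%g (row_perm s x)| = _) ?norm_row_perm_le//.
by rewrite -row_permM mulVg row_perm1.
Qed.

Lemma norm_row_le (R : realType) m n i (x : 'M[R]_(m, n)) : `|row i x| <= `|x|.
Proof.
rewrite ![`|_|]mx_normrE; apply/bigmax_leP; split=> [|[k j] _ /=].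
  exact: bigmax_ge_id.
by rewrite mxE; apply: (le_bigmax _ (fun ij => `|x ij.1 ij.2|) (i, j)).
Qed.

(** * Separation of the rows of a configuration *)

Section Separation.
Variables (R : realType) (n : nat).
Local Notation X := (configuration R n).

Lemma row_perm_rowE m k (s : 'S_m) i (x : 'M[R]_(m, k)) :
  row i (row_perm s x) = row (s i) x.
Proof. by apply/rowP => j; rewrite !mxE. Qed.

(** Two nearby matrices are allowed for the sake of both uses: [y = z] gives openness of
    [distinct_points], and [z] a row permutation of [y] gives injectivity of the projection near
    [x]. *)
Lemma distinct_points_separation (x : 'M[R]_(n, 3)) : distinct_points x ->
  exists2 e : R, 0 < e & forall i j y z, i != j -> `|x - y| < e ->
    `|x - z| < e -> row i y <> row j z.
Proof.
move=> dx.
(* The default value 1 keeps [d] positive when there is no pair of distinct indices. *)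
pose d := \big[Num.min/1]_(ij : 'I_n * 'I_n | ij.1 != ij.2)
  `|row ij.1 x - row ij.2 x|.
have d0 : 0 < d.
  apply: lt_bigmin => // -[i j] /= /eqP ij.
  by rewrite normr_gt0 subr_eq0; apply/eqP; exact: dx.
exists (d / 2); first by rewrite divr_gt0.
move=> i j y z ij xy xz yz.
have : d <= `|row i x - row j x| by exact: (@bigmin_le_cond _ _ _ _ (i, j)).
apply/negP; rewrite -ltNge (splitr d).
(* If row [i] of [y] equals row [j] of [z], these rows cancel, leaving two terms of norm less than
   [d / 2]. *)
rewrite (_ : row i x - row j x = row i (x - y) - row j (x - z)).
  apply: le_lt_trans (ler_normB _ _) _.
  by apply: ltrD; apply: le_lt_trans (norm_row_le _ _) _.
by rewrite !linearB /= yz opprK addrA addrAC subrK.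
Qed.

Lemma open_distinct_points : open (@distinct_points R n).
Proof.
rewrite openE => x /distinct_points_separation[e e0 he]; apply/nbhs_ballP.
exists e => //= y; rewrite mx_norm_ball => xy i j /eqP ij.
exact: (he _ _ _ _ ij xy xy).
Qed.

End Separation.

(** * The metric on the set of orbits *)

Section OrbitMetric.
Variables (R : realType) (n : nat) (G : {group 'S_n}).
Local Notation X := (configuration R n).

(** A separate name for the set of orbits, inheriting only its choice structure, so that its
    topology comes from the metric and not from the quotient. *)
Definition orbit_metric : Type := {eq_quot (same_orbit_equiv R G)}.
HB.instance Definition _ := Choice.on orbit_metric.

Definition orbit_pi (x : X) : orbit_metric :=
  \pi_{eq_quot (same_orbit_equiv R G)} x.

Lemma orbit_piP x y :
  orbit_pi x = orbit_pi y <->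
  exists2 s, s \in G & perm_configuration s x = y.
Proof.
split=> [/eqmodP/existsP[s /andP[sG /eqP sx]]|[s sG sx]]; first by exists s.
by apply/eqmodP/existsP; exists s; rewrite sG; apply/eqP.
Qed.

Lemma orbit_pi_surj (p : orbit_metric) : exists x, orbit_pi x = p.
Proof. by exists (repr p); exact: reprK. Qed.

Let D (p q : orbit_metric) (s : 'S_n) : R :=
  `|\val (repr p : X) - row_perm s (\val (repr q : X))|.

(** Canonical representatives make this a function of orbits at once; [orbit_dist_le] and
    [orbit_dist_attained] then free it from that choice. *)
Definition orbit_dist (p q : orbit_metric) : R :=
  D p q [arg min_(s < 1%g in G) D p q s]%O.

Lemma orbit_dist_min p q :
  (exists2 s, s \in G & orbit_dist p q = D p q s) /\
  (forall s, s \in G -> orbit_dist p q <= D p q s).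
Proof.
rewrite /orbit_dist; case: Order.TotalTheory.arg_minP => [|s sG h].
  exact: group1.
by split=> //; exists s.
Qed.

Lemma orbit_pi_repr x :
  exists2 s, s \in G & \val x = row_perm s (\val (repr (orbit_pi x) : X)).
Proof.
have /orbit_piP[s sG sx] : orbit_pi (repr (orbit_pi x)) = orbit_pi x.
  exact: reprK.
by exists s => //; rewrite -[in LHS]sx.
Qed.

(** If [x] and [y] are the translates by [s] and [t] of the chosen representatives, then [s^-1 * t]
    is a candidate in the minimum, with value [|x - y|] by invariance of the norm. *)
Lemma orbit_dist_le x y :
  orbit_dist (orbit_pi x) (orbit_pi y) <= `|\val x - \val y|.
Proof.
have [s sG xE] := orbit_pi_repr x; have [t tG yE] := orbit_pi_repr y.
have [_ /(_ (s^-1 * t)%g)] := orbit_dist_min (orbit_pi x) (orbit_pi y).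
rewrite groupM ?groupV// => /(_ isT) /le_trans; apply.
rewrite /D -(norm_row_perm s) linearB /= -row_permM mulgA mulgV mul1g.
by rewrite -xE -yE.
Qed.

(** With [orbit_dist_le], this says that the distance from the orbit of any given [x] to [q] is the
    minimum of [|x - y|] over [y] in [q]. *)
Lemma orbit_dist_attained x q :
  exists2 y, orbit_pi y = q & orbit_dist (orbit_pi x) q = `|\val x - \val y|.
Proof.
have [s sG xE] := orbit_pi_repr x.
have [[t tG ->] _] := orbit_dist_min (orbit_pi x) q.
exists (perm_configuration (s * t)%g (repr q)).
  rewrite -[RHS](reprK q); apply/esym/orbit_piP.
  by exists (s * t)%g => //; rewrite groupM.
rewrite val_perm_configuration xE row_permM.
by rewrite -linearB /= norm_row_perm.
Qed.

Let orbit_distxx p : orbit_dist p p = 0.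
Proof.
have [x <-] := orbit_pi_surj p; apply/eqP; rewrite eq_le.
have := orbit_dist_le x x; rewrite subrr normr0 => -> /=.
exact: normr_ge0.
Qed.

Let orbit_dist_positivity p q : orbit_dist p q = 0 -> p = q.
Proof.
have [x <-] := orbit_pi_surj p.
have [y <- ->] := orbit_dist_attained x q.
by move/normr0_eq0/eqP; rewrite subr_eq0 => /eqP/val_inj ->.
Qed.

Let orbit_dist_sym p q : orbit_dist p q = orbit_dist q p.
Proof.
suff le a b : orbit_dist a b <= orbit_dist b a.
  by apply/eqP; rewrite eq_le !le.
have [x <-] := orbit_pi_surj b.
have [y <- ->] := orbit_dist_attained x a.
by rewrite distrC; exact: orbit_dist_le.
Qed.

Let orbit_dist_triangle q p r :
  orbit_dist p r <= orbit_dist p q + orbit_dist q r.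
Proof.
have [x <-] := orbit_pi_surj p.
(* Choosing [y] nearest to [x], then [z] nearest to [y], reduces the claim to the triangle
   inequality for matrices. *)
have [y <- ->] := orbit_dist_attained x q.
have [z <- ->] := orbit_dist_attained y r.
by apply: le_trans (orbit_dist_le x z) _; exact: ler_distD.
Qed.

HB.instance Definition _ := isMetric.Build R orbit_metric
  orbit_distxx orbit_dist_positivity orbit_dist_sym orbit_dist_triangle.

Local Notation Q := (orbit_space R G).

(** * The quotient topology and the projection *)

Lemma nbhs_configurationP (x : X) (A : set X) :
  nbhs x A <->
  exists2 e : R, 0 < e & forall y : X, `|\val x - \val y| < e -> A y.
Proof.
split=> [/nbhs_ballP[e e0 eA]|[e e0 eA]].
  by exists e => // y xy; apply: eA; rewrite -initial_ballE /= mx_norm_ball.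
apply/nbhs_ballP; exists e => // y; rewrite -initial_ballE /= mx_norm_ball.
exact: eA.
Qed.

Lemma metrizable_orbit_space : metrizable R Q.
Proof.
exists orbit_metric, id, id; split=> //.
(* The projection does not increase distances. *)
- apply/quotient_continuous => x A /nbhs_ballP[e /= e0 eA].
  apply/nbhs_configurationP; exists e => // y xy; apply: eA.
  by rewrite ballEmdist /=; apply: le_lt_trans xy; exact: orbit_dist_le.
(* Conversely, an orbit at distance less than [e] from that of [x] has a point in the [e]-ball
   around [x], which projects into [A]. *)
- move=> p A pA; have [x xp] := orbit_pi_surj p.
  have /nbhs_configurationP[e e0 eA] : nbhs x (\pi_Q @^-1` A).
    by rewrite -xp in pA; exact: (@pi_continuous _ _ x A pA).
  apply/nbhs_ballP; exists e => // q; rewrite ballEmdist /= -xp.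
  rewrite /mdist /=; have [y <- ->] := orbit_dist_attained x q.
  exact: eA.
Qed.

Lemma perm_configuration_continuous s :
  continuous (@perm_configuration R n s).
Proof.
move=> x A /nbhs_configurationP[e e0 eA]; apply/nbhs_configurationP.
exists e => // y xy; apply: eA.
by rewrite !val_perm_configuration -linearB norm_row_perm.
Qed.

(** The saturation of [A] is the union of its preimages under the elements of [G], which act
    continuously. *)
Lemma orbit_space_pi_open (A : set X) : open A -> open (\pi_Q @` A).
Proof.
move=> oA; rewrite /open /= /quotient_open.
rewrite (_ : _ @^-1` _ =
    \bigcup_(s in [set s | s \in G]) (@perm_configuration R n s @^-1` A)).
  apply: bigcup_open => s _; apply: open_comp => // x _.
  exact: perm_configuration_continuous.
apply/seteqP; split=> [x [y Ay /esym]|x [s /= sG sA]].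
  by move=> /orbit_piP[s sG sx]; exists s => //=; rewrite sx.
exists (perm_configuration s x) => //; apply/esym/orbit_piP.
by exists s.
Qed.

Lemma hausdorff_orbit_space : hausdorff_space Q.
Proof.
have [M [f [g [cf cg fK gK]]]] := metrizable_orbit_space.
move=> p q pq; apply: (can_inj fK); apply: metric_hausdorff => A B fA fB.
have [r [Ar Br]] := pq _ _ (cf p A fA) (cf q B fB).
by exists (f r).
Qed.

Lemma second_countable_orbit_space : @second_countable Q.
Proof.
apply: (second_countable_open_image (@pi_continuous _ _)
  orbit_space_pi_open orbit_pi_surj).
exact: second_countable_initial (second_countable_matrix _ _ _).
Qed.

End OrbitMetric.

(** * Euclidean charts *)

Lemma configuration_open_val (R : realType) n (A : set (configuration R n)) :
  open A -> open (set_val @` A).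
Proof.
move=> [B oB <-].
rewrite (_ : _ @` _ = B `&` @distinct_points R n).
  by apply: openI => //; exact: open_distinct_points.
apply/seteqP; split=> [_ [x Bx <-]|x [Bx dx]].
  by split=> //; exact: set_mem (svalP x).
by exists (exist _ x (mem_set dx)).
Qed.

(** Copying entries does not increase the sup distance. *)
Lemma continuous_reindex_mx (R : realType) m n p q
    (f : 'M[R]_(m, n) -> 'M[R]_(p, q)) :
  (forall i j, exists k l, forall x, f x i j = x k l) -> continuous f.
Proof.
move=> fE x A /nbhs_ballP[e /= e0 eA]; apply/nbhs_ballP; exists e => // y [_ xy].
apply: eA; split=> // i j; have [k [l fkl]] := fE i j.
by rewrite !fkl; exact: xy.
Qed.

(** The cast turns the length [m * n] of [mxvec] into [n * m], so that n x 3 matrices land in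
    dimension [3 * n]. *)
Lemma homeomorphic_matrix_rV (R : realType) m n :
  homeomorphic 'M[R]_(m, n) 'rV[R]_(n * m).
Proof.
exists (fun x => castmx (erefl, mulnC m n) (mxvec x)).
exists (fun x => vec_mx (castmx (erefl, mulnC n m) x)); split.
- apply: continuous_reindex_mx => i j.
  case/mxvec_indexP Ej : _ / (cast_ord (esym (mulnC m n)) j) => [k l].
  by exists k, l => x; rewrite castmxE Ej ord1 mxvecE.
- apply: continuous_reindex_mx => i j.
  exists ord0, (cast_ord (esym (mulnC n m)) (mxvec_index i j)) => x.
  by rewrite mxE castmxE; congr (x _ _); exact: ord1.
- by move=> x; rewrite castmx_comp castmx_id mxvecK.
- by move=> x; rewrite vec_mxK castmx_comp castmx_id.
Qed.

Lemma homeomorphic_open (S T : topologicalType) (f : S -> T) (g : T -> S) :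
  continuous g -> cancel f g -> cancel g f ->
  forall A : set S, open A -> open (f @` A).
Proof.
move=> cg fK gK A oA; rewrite (_ : f @` A = g @^-1` A).
  by apply: open_comp => // x _; exact: cg.
apply/seteqP; split=> [_ [x Ax <-]|y Ay]; first by rewrite /= fK.
by exists (g y).
Qed.

Lemma orbit_space_locally_euclidean (R : realType) n (G : {group 'S_n}) :
  locally_euclidean R (3 * n) (orbit_space R G).
Proof.
move=> p; have [x xp] := orbit_pi_surj p.
have [e e0 he] := distinct_points_separation (set_mem (svalP x)).
pose W : set (configuration R n) := [set y | `|\val x - \val y| < e].
have oW : open W.
  rewrite (_ : W = set_val @^-1` ball (\val x) e).
    by exists (ball (\val x) e) => //; exact: ball_open.
  by apply/seteqP; split=> y /=; rewrite mx_norm_ball.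
have [h [k [ch ck hK kK]]] := homeomorphic_matrix_rV R n 3.
pose j := h \o (set_val : configuration R n -> _).
have jo A : open A -> open (j @` A).
  move=> /configuration_open_val oA.
  by rewrite -image_comp; exact: (homeomorphic_open ck hK kK oA).
(* If [z] in [W] is the translate of [y] in [W] by [s] and [s i != i], then row [s i] of [y] equals
   row [i] of [z], against the separation around [x]. *)
have piI : {in W &, injective (\pi_(orbit_space R G) : configuration R n -> _)}.
  move=> y z /set_mem Wy /set_mem Wz /orbit_piP[s sG syz].
  suff s1 : s = 1%g.
    by rewrite -syz s1; apply: val_inj; rewrite val_perm_configuration row_perm1.
  apply/permP => i; rewrite perm1; apply/eqP/negPn/negP => si.
  apply: (he _ _ _ _ si Wy Wz).
  by rewrite -syz val_perm_configuration row_perm_rowE.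
exists (\pi_(orbit_space R G) @` W), (j @` W); split.
- exact: orbit_space_pi_open.
- by exists x => //; rewrite /W /= subrr normr0.
- exact: jo.
(* The chart passes through [W], on which both the projection and [j] are continuous, open and
   injective. *)
- apply: (homeomorphic_trans (T := W)).
    apply: homeomorphic_sym; apply: homeomorphic_image => //.
    + exact: pi_continuous.
    + exact: orbit_space_pi_open.
  apply: homeomorphic_image => //.
  + move=> y; apply: continuous_comp; [exact: initial_continuous|exact: ch].
  + by move=> y z _ _ /(can_inj hK)/val_inj.
Qed.

Theorem proposition5 (R : realType) (n : nat) (hn : (0 < n)%N)
    (G : {group 'S_n}) :
  metrizable R (orbit_space R G) /\
  topological_manifold R (3 * n)%N (orbit_space R G).
Proof.
split; first exact: metrizable_orbit_space.
split.
- exact: hausdorff_orbit_space.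
- exact: second_countable_orbit_space.
- exact: orbit_space_locally_euclidean.
Qed.
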